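(* Each of the three graphs $P_4[2,2,1,2]$, $P_4[2,2,2,1]$ and $P_4[2,2,2,2]$ has a finite deletion host.
   Context: $P_4[a,b,c,d]$ denotes the graph obtained from the path on four vertices $v_1v_2v_3v_4$ by replacing the consecutive vertices $v_1,v_2,v_3,v_4$ with disjoint cliques of orders $a,b,c,d$ respectively and joining consecutive cliques completely (with no edges between cliques corresponding to nonadjacent path vertices). A finite deletion host for a graph $H$ is a finite simple graph $G$ such that $E(G)\neq\varnothing$, $G$ contains no induced subgraph isomorphic to $H$, and for every $e\in E(G)$ the graph $G-e$ (edge deleted, vertices kept) contains an induced subgraph isomorphic to $H$. *)

(* Defs.v *)
From mathcomp Require Import all_boot.

Set Implicit Arguments.
Unset Strict Implicit.
Unset Printing Implicit Defensive.

Record sgraph := SGraph {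
  vertex :> finType;
  adj : rel vertex;
  adj_sym : symmetric adj;
  adj_irr : irreflexive adj }.

Notation "x -- y" := (adj x y) (at level 30).

Definition edges (G : sgraph) : {set {set G}} :=
  [set [set p.1; p.2] | p in [pred p : G * G | p.1 -- p.2]].

Definition graph_iso (G H : sgraph) : Prop :=
  exists2 f : G -> H, bijective f & forall x y, f x -- f y = x -- y.

Section Induced.
Variables (G : sgraph) (S : {set G}).

Definition induced_adj : rel {x : G | x \in S} :=
  fun x y => val x -- val y.

Lemma induced_sym : symmetric induced_adj.
Proof. by move=> x y; apply: adj_sym. Qed.

Lemma induced_irr : irreflexive induced_adj.
Proof. by move=> x; apply: adj_irr. Qed.

Definition induced : sgraph := SGraph induced_sym induced_irr.
End Induced.

Definition contains_induced (G H : sgraph) : Prop :=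
  exists S : {set G}, graph_iso (induced S) H.

Section DeleteEdge.
Variables (G : sgraph) (e : {set G}).

Definition del_adj : rel G := fun x y => x -- y && ([set x; y] != e).

Lemma del_sym : symmetric del_adj.
Proof. by move=> x y; rewrite /del_adj adj_sym setUC. Qed.

Lemma del_irr : irreflexive del_adj.
Proof. by move=> x; rewrite /del_adj adj_irr. Qed.

Definition del_edge : sgraph := SGraph del_sym del_irr.
End DeleteEdge.

Section Path.
Variable n : nat.

Definition path_adj : rel 'I_n :=
  fun i j => (i.+1 == j :> nat) || (j.+1 == i :> nat).

Lemma path_sym : symmetric path_adj.
Proof. by move=> i j; rewrite /path_adj orbC. Qed.

Lemma path_irr : irreflexive path_adj.
Proof. by move=> i; rewrite /path_adj orbb -(addn1 i) -{2}(addn0 i) eqn_add2l. Qed.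

Definition path_graph : sgraph := SGraph path_sym path_irr.
End Path.

Section CliqueBlowup.
Variables (G : sgraph) (k : G -> nat).

Definition blowup_vertex : finType := {v : G & 'I_(k v)}.

Definition blowup_adj : rel blowup_vertex :=
  fun x y => (x != y) && ((tag x == tag y) || tag x -- tag y).

Lemma blowup_sym : symmetric blowup_adj.
Proof.
by move=> x y; rewrite /blowup_adj eq_sym [tag x == _]eq_sym adj_sym.
Qed.

Lemma blowup_irr : irreflexive blowup_adj.
Proof. by move=> x; rewrite /blowup_adj eqxx. Qed.

Definition clique_blowup : sgraph := SGraph blowup_sym blowup_irr.
End CliqueBlowup.

Definition P4 (a b c d : nat) : sgraph :=
  @clique_blowup (path_graph 4) (fun i : 'I_4 => nth 0 [:: a; b; c; d] i).

Definition finite_deletion_host (H G : sgraph) : Prop :=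
  [/\ edges G != set0,
      ~ contains_induced G H
    & forall e : {set G}, e \in edges G -> contains_induced (del_edge e) H].

Definition has_finite_deletion_host (H : sgraph) : Prop :=
  exists G : sgraph, finite_deletion_host H G.

(* Main.v *)
(** The hosts are circulant graphs: distances {3,5,6,9} in Z/19, distances
    {1,2,3,5} in Z/13, and the Paley graph on Z/29 respectively.  Translations act transitively on the vertices, so freeness needs a
    backtracking search only from a fixed first vertex, and criticality needs
    one copy of the pattern for each distance. *)
Require Import Defs.
From mathcomp Require Import all_boot.
From mathcomp Require Import ssralg zmodp.

Set Implicit Arguments.
Unset Strict Implicit.
Unset Printing Implicit Defensive.

(** Embeddings avoid subset types: an injective map is a bijection onto its image, and that image is
    the vertex set sought. *)
Lemma contains_inducedP (G H : sgraph) :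
  contains_induced G H <->
  exists2 f : H -> G, injective f & forall x y, f x -- f y = x -- y.
Proof.
split=> [[S [f [g fK gK] fadj]]|[f finj fadj]].
  exists (fun h => val (g h)) => [x y /val_inj /(can_inj gK) //|x y].
  by have := fadj (g x) (g y); rewrite !gK => ->.
exists [set f h | h in H].
have fS h : f h \in [set f h | h in H] by apply: imset_f.
pose f' h : induced [set f h | h in H] := exist _ (f h) (fS h).
have f'inj : injective f' by move=> x y [] /finj.
have [|g f'K gK] := inj_card_bij f'inj.
  by rewrite card_sig card_imset.
exists g => [|x y]; first by exists f'.
by rewrite -fadj -{2}[x]gK -{2}[y]gK.
Qed.

Lemma set2_eqE (T : finType) (u v x y : T) :
  ([set u; v] == [set x; y]) =
  (u == x) && (v == y) || (u == y) && (v == x).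
Proof.
apply/eqP/orP => [E|[|] /andP[/eqP-> /eqP->] //]; last by rewrite setUC.
have: u \in [set x; y] by rewrite -E set21.
have: v \in [set x; y] by rewrite -E set22.
have: x \in [set u; v] by rewrite E set21.
have: y \in [set u; v] by rewrite E set22.
rewrite !inE ![_ == u]eq_sym ![_ == v]eq_sym.
by case: (u == x); case: (u == y); case: (v == x); case: (v == y); auto.
Qed.

(* Labels are the indices of the four path vertices, so that a pair is a
   vertex together with the clique it is meant for. *)
Definition near (i j : nat) := [|| i == j, i.+1 == j | j.+1 == i].

Definition compat (T : eqType) (r : rel T) : rel (nat * T) :=
  fun p q => (p.2 != q.2) && (r p.2 q.2 == near p.1 q.1).

(* The two middle cliques come first to keep the backtracking search small. *)
Definition labels (a b c d : nat) : seq nat :=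
  nseq b 1 ++ nseq c 2 ++ nseq a 0 ++ nseq d 3.

(** Only pairs in list order are tested; for symmetric [r] this covers all pairs. *)
Definition is_copy (T : eqType) (r : rel T) (ls : seq nat) (vs : seq T) :=
  (size vs == size ls) && pairwise (compat r) (zip ls vs).

Lemma is_copy_map (T U : eqType) (f : T -> U) (r : rel T) (s : rel U) ls vs :
    injective f -> {mono f : x y / r x y >-> s x y} ->
  is_copy s ls (map f vs) = is_copy r ls vs.
Proof.
move=> finj fr; rewrite /is_copy size_map.
have ->: zip ls (map f vs) = [seq (p.1, f p.2) | p <- zip ls vs].
  by elim: vs ls => [|v vs IH] [|l ls] //=; rewrite IH.
rewrite pairwise_map; congr (_ && _).
by apply: eq_pairwise => p q; rewrite /compat /= (inj_eq finj) fr.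
Qed.

Section P4Copies.
Variables a b c d : nat.
Notation H := (P4 a b c d).

Let sz (i : 'I_4) := nth 0 [:: a; b; c; d] i.

Let label (x : H) : nat := val (tag x).

(** The cliques come in the order used by [labels], so positions in the two lists correspond. *)
Let vertices : seq H :=
  [seq Tagged (fun i => 'I_(sz i)) j
     | i <- [:: inord 1; inord 2; inord 0; inord 3], j <- enum 'I_(sz i)].

Let vertices_uniq : uniq vertices.
Proof.
apply: allpairs_uniq_dep => [|i _|[i j] [i' j'] _ _ //]; last exact: enum_uniq.
by rewrite /= !inE -!val_eqE /= !inordK.
Qed.

Let mem_vertices (x : H) : x \in vertices.
Proof.
case: x => i j; apply/allpairsPdep; exists i, j; rewrite mem_enum; split=> //.
rewrite !inE -!val_eqE /= !inordK //.
by case: i {j} => [[|[|[|[|]]]]].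
Qed.

Let map_label : map label vertices = labels a b c d.
Proof.
rewrite /vertices /labels /= cats0 !map_cat.
have E i : map label [seq Tagged (fun i => 'I_(sz i)) j | j <- enum 'I_(sz i)]
           = nseq (sz i) (val i).
  by rewrite -map_comp -[in RHS](size_enum_ord (sz i)); elim: (enum _) => //= j s ->.
by rewrite !E /sz /= !inordK.
Qed.

Let P4_adjE (x y : H) : x -- y = (x != y) && near (label x) (label y).
Proof. by []. Qed.

Lemma P4_copyP (G : sgraph) (v0 : G) :
  contains_induced G H <->
  exists vs : seq G, is_copy (@adj G) (labels a b c d) vs.
Proof.
rewrite -map_label; split=> [/contains_inducedP[f finj fadj]|].
  exists (map f vertices); rewrite /is_copy !size_map eqxx /= zip_map.
  rewrite pairwise_map; move: vertices_uniq; rewrite uniq_pairwise.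
  apply: sub_pairwise => x y /= xy.
  by rewrite /compat /= (inj_eq finj) fadj P4_adjE xy eqxx.
case=> vs /andP[/eqP szv /(pairwiseP (0, v0)) cvs].
apply/contains_inducedP.
(* The position in [vertices] decides the image; all indices are in range, so the default [v0] is
   never returned. *)
pose f x := nth v0 vs (index x vertices).
have ltv x : index x vertices < size vertices by rewrite index_mem.
have fP x y : x != y -> (f x != f y) && (f x -- f y == near (label x) (label y)).
  have near_sym i j : near i j = near j i.
    by rewrite /near eq_sym [(i.+1 == j) || _]orbC.
  wlog lt_xy : x y / index x vertices < index y vertices => [IH xy|xy].
    have: index x vertices != index y vertices.
      apply: contraNneq xy => e.
      by rewrite -[x](nth_index x (mem_vertices x)) e nth_index.
    rewrite neq_ltn => /orP[/IH/(_ xy) //|/IH].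
    by rewrite [y == x]eq_sym [f y == _]eq_sym adj_sym near_sym => /(_ xy).
  rewrite size_map in szv.
  have := cvs _ _ _ _ lt_xy; rewrite !inE size_zip size_map szv minnn.
  move=> /(_ (ltv x) (ltv y)).
  rewrite !nth_zip ?size_map //= /compat /=.
  by rewrite !(nth_map x) // !nth_index.
exists f => [x y fxy|x y].
  by apply/eqP; apply/negP => /negP /fP; rewrite fxy eqxx.
rewrite P4_adjE; have [->|/fP/andP[_ /eqP //]] := eqVneq x y.
by rewrite adj_irr.
Qed.
End P4Copies.

(** Subtraction modulo [m], for [v <= m], on natural numbers so that the search can be run by
    computation. *)
Definition diff (m u v : nat) := (u + (m - v)) %% m.

(** Both differences are tested, so [D] lists distances only up to sign. *)
Definition circ (m : nat) (D : seq nat) : rel nat :=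
  fun u v => (u != v) && ((diff m u v \in D) || (diff m v u \in D)).

Lemma circ_sym m D : symmetric (circ m D).
Proof. by move=> u v; rewrite /circ eq_sym orbC. Qed.

Lemma circ_irr m D : irreflexive (circ m D).
Proof. by move=> u; rewrite /circ eqxx. Qed.

(* Indexing is shifted: [circulant n D] lives on Z/(n+1). *)
Definition circulant (n : nat) (D : seq nat) : sgraph :=
  @SGraph 'I_n.+1 (relpre val (circ n.+1 D))
    (fun u v => circ_sym n.+1 D u v) (fun u => circ_irr n.+1 D u).

Lemma diffE n (x y : 'I_n.+1) : diff n.+1 x y = val (x - y)%R.
Proof. by rewrite /diff -modnDmr. Qed.

Lemma circ_shift n D (t x y : 'I_n.+1) :
  circ n.+1 D (x + t)%R (y + t)%R = circ n.+1 D x y.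
Proof.
rewrite /circ !diffE !val_eqE (inj_eq (GRing.addIr t)).
have subK (u v : 'I_n.+1) : (u + t - (v + t) = u - v)%R.
  by rewrite [(v + t)%R]GRing.addrC GRing.addrKA.
by rewrite !subK.
Qed.

Definition circ_del (m : nat) (D : seq nat) (e : nat) : rel nat :=
  fun u v => circ m D u v && ~~ ((u == 0) && (v == e) || (u == e) && (v == 0)).

(* Filtering before the recursive call matters: a conjunction inside [has] is
   evaluated eagerly by the virtual machine, so nothing would be pruned. *)
Fixpoint extends (r : rel nat) (m : nat) (ls : seq nat) (acc : seq (nat * nat)) :=
  if ls is l :: ls' then
    has (fun v => extends r m ls' ((l, v) :: acc))
        [seq v <- iota 0 m | all (fun p => compat r p (l, v)) acc]
  else true.

(** The search is complete: the next vertex of a genuine copy always survives the filter, so a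
    failed search rules out every copy extending [acc]. *)
Lemma extendsP r m ls vs acc :
    size vs = size ls -> all (gtn m) vs ->
    pairwise (compat r) (zip ls vs) -> allrel (compat r) acc (zip ls vs) ->
  extends r m ls acc.
Proof.
elim: ls vs acc => [|l ls IH] [|v vs] //= acc [szv] /andP[vm vsm].
move=> /andP[cv cvs]; rewrite allrel_consr => /andP[accv accvs].
apply/hasP; exists v; first by rewrite mem_filter accv mem_iota.
by rewrite (IH vs) // allrel_consl cv.
Qed.

(* The search starts from a vertex of the second clique, translated to 0;
   [w e] is a copy of the pattern after deletion of the edge {0,e}. *)
Lemma circulant_host n D a b c d (w : nat -> seq nat) :
    let m := n.+1 in
    0 < b -> has (fun e => 0 < e < m) D ->
    ~~ extends (circ m D) m (behead (labels a b c d)) [:: (1, 0)] ->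
    all (fun e => all (gtn m) (w e)
                  && is_copy (circ_del m D e) (labels a b c d) (w e)) D ->
  finite_deletion_host (P4 a b c d) (circulant n D).
Proof.
move=> m b_gt0 /hasP[e eD /andP[e_gt0 em]] free crit; split.
- apply/set0Pn; exists [set ord0; Ordinal em].
  apply/imsetP; exists (ord0, Ordinal em) => //; rewrite !inE /=.
  have de : diff m e 0 = e by rewrite /diff subn0 modnDr modn_small.
  by rewrite /circ /= de eD orbT andbT eq_sym -lt0n.
- move=> /(P4_copyP _ _ _ _ (ord0 : circulant n D))[].
  case: b b_gt0 free {crit} => //= b _ free [|v vs] // cvs.
  (* Subtracting [v] is an automorphism that moves the first listed vertex to 0. *)
  have: is_copy (circ m D) (labels a b.+1 c d) [seq val (u - v)%R | u <- v :: vs].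
    move: cvs; pose f u := val (u - v)%R.
    rewrite -(is_copy_map (f := f) (s := circ m D)) // => x y.
      by move/val_inj/GRing.addIr.
    exact: circ_shift.
  rewrite map_cons GRing.subrr /is_copy /= => /and3P[/eqP[szv] cv cvs'].
  case/negP: free; apply: extendsP szv _ cvs' _.
    by apply/allP => _ /mapP[u _ ->]; apply: ltn_pmod.
  by rewrite allrel_consl cv allrel0l.
move=> _ /imsetP[[x y]] /[!inE] /= xy ->.
(* The edge is unordered, so its ends may be exchanged to bring [y - x] into [D]. *)
wlog yxD: x y xy / diff m y x \in D => [IH|].
  have /andP[_ /orP[xyD|/IH]] := xy; last exact.
  by rewrite setUC; apply: IH => //; rewrite circ_sym.
have /allP/(_ _ yxD)/andP[wm cw] := crit.
apply/(@P4_copyP _ _ _ _ (@del_edge (circulant n D) [set x; y]) ord0).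
(* Translation by [x] carries the edge {0, y - x} to {x, y}, and the given copy with it. *)
exists [seq (inord u + x : 'I_n.+1)%R | u <- w (diff m y x)].
have wE : w (diff m y x) = map (@nat_of_ord m) (map inord (w (diff m y x))).
  rewrite -map_comp -[LHS]map_id; apply/eq_in_map => u /(allP wm) um /=.
  by rewrite inordK.
move: cw; rewrite {1}wE.
rewrite (is_copy_map (r := relpre val (circ_del m D (diff m y x)))) //; last first.
  exact: val_inj.
rewrite (map_comp (fun u => (u + x)%R)) => cw.
rewrite (is_copy_map (r := relpre val (circ_del m D (diff m y x)))) // => [u v|u v].
  exact: GRing.addIr.
rewrite /= /del_adj /= circ_shift /circ_del set2_eqE diffE; congr (_ && ~~ _).
have E0 (t : 'I_n.+1) : (t + x == x)%R = (t == 0 :> nat).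
  rewrite -{2}[x]GRing.add0r (inj_eq (GRing.addIr x)).
  by rewrite -val_eqE.
have Ey (t : 'I_n.+1) : (t + x == y)%R = (t == val (y - x)%R :> nat).
  by rewrite val_eqE [RHS]eq_sym GRing.subr_eq eq_sym.
by rewrite !E0 !Ey.
Qed.

(** Vertices follow the order of [labels]; the default branch serves the remaining distance, 9 here
    and 5 in [copies13]. *)
Definition copies19 (e : nat) : seq nat :=
  match e with
  | 3 => [:: 6; 9; 0; 3; 12; 5; 10]
  | 5 => [:: 6; 9; 15; 0; 3; 2; 5]
  | 6 => [:: 3; 9; 0; 6; 12; 5; 10]
  | _ => [:: 0; 16; 6; 10; 13; 9; 12]
  end.

Definition copies13 (e : nat) : seq nat :=
  match e with
  | 1 => [:: 2; 12; 0; 10; 1; 4; 8]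
  | 2 => [:: 1; 3; 2; 4; 0; 11; 7]
  | 3 => [:: 5; 8; 0; 10; 3; 6; 12]
  | _ => [:: 8; 10; 0; 11; 5; 7; 1]
  end.

(* Multiplication by a square is an automorphism of the Paley graph, so the
   copy for the edge {0,1} yields those for all other distances. *)
Definition copies29 (e : nat) : seq nat :=
  [seq (e * x) %% 29 | x <- [:: 4; 13; 17; 26; 0; 9; 1; 21]].

Theorem proposition7p1 :
  has_finite_deletion_host (P4 2 2 1 2) /\
  has_finite_deletion_host (P4 2 2 2 1) /\
  has_finite_deletion_host (P4 2 2 2 2).
Proof.
split; last split.
- exists (circulant 18 [:: 3; 5; 6; 9]).
  by apply: (@circulant_host _ _ _ _ _ _ copies19); vm_compute.
- exists (circulant 12 [:: 1; 2; 3; 5]).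
  by apply: (@circulant_host _ _ _ _ _ _ copies13); vm_compute.
(* Up to sign these are the nonzero squares modulo 29. *)
exists (circulant 28 [:: 1; 4; 5; 6; 7; 9; 13]).
by apply: (@circulant_host _ _ _ _ _ _ copies29); vm_compute.
Qed.
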